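(* Let $p$ be a prime and let $A$ be an Abelian $p$-group whose reduced part is separable. Then $A$ is $\omega$-strongly homogeneous: for any $n$ and any $a_1,\dots,a_n,b_1,\dots,b_n\in A$ with $\mathrm{tp}^A(a_1,\dots,a_n)=\mathrm{tp}^A(b_1,\dots,b_n)$ there exists an automorphism $\varphi$ of $A$ such that $\varphi(a_i)=b_i$ for all $i=1,\dots,n$.
   Context: For a group $G$ and a finite tuple $(g_1,\dots,g_n)$ of elements of $G$, the type $\mathrm{tp}^G(g_1,\dots,g_n)$ is the set of all first-order formulas in the language of group theory, in free variables $x_1,\dots,x_n$, that are true on $(g_1,\dots,g_n)$ in $G$. Every Abelian $p$-group $A$ decomposes as $A=D\oplus\overline A$ with $D$ divisible and $\overline A$ reduced, i.e. having no nonzero divisible subgroups; $\overline A$ is called the reduced part (unique up to isomorphism). A nonzero element $a$ of a $p$-group $G$ has infinite height if for every $r$ the equation $p^rx=a$ is solvable in $G$; a reduced Abelian $p$-group is separable if it has no nonzero elements of infinite height. *)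

(* Defs.v *)
From mathcomp Require Import all_boot all_algebra.
From mathcomp Require Import boolp classical_sets.

Set Implicit Arguments.
Unset Strict Implicit.
Unset Printing Implicit Defensive.

Import GRing.Theory.
Local Open Scope classical_set_scope.
Local Open Scope ring_scope.

(** First-order language of groups, in additive notation.  [group_term n] and
    [group_formula n] are the terms and formulas whose free variables are among
    x_0, ..., x_(n-1).  A quantifier binds variable 0 of its body, whose other
    variables are shifted by one. *)

Inductive group_term (n : nat) : Type :=
| TVar of 'I_n
| TZero
| TOpp of group_term n
| TAdd of group_term n & group_term n.

Inductive group_formula : nat -> Type :=
| FEq n of group_term n & group_term n : group_formula n
| FNot n of group_formula n : group_formula n
| FAnd n of group_formula n & group_formula n : group_formula n
| FOr n of group_formula n & group_formula n : group_formula n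
| FImp n of group_formula n & group_formula n : group_formula n
| FForall n of group_formula n.+1 : group_formula n
| FExists n of group_formula n.+1 : group_formula n.

Fixpoint term_eval (A : zmodType) n (v : n.-tuple A) (t : group_term n) : A :=
  match t with
  | TVar i => tnth v i
  | TZero => 0
  | TOpp t1 => - term_eval v t1
  | TAdd t1 t2 => term_eval v t1 + term_eval v t2
  end.

Fixpoint holds (A : zmodType) n (f : group_formula n) : n.-tuple A -> Prop :=
  match f in group_formula n return n.-tuple A -> Prop with
  | FEq _ t1 t2 => fun v => term_eval v t1 = term_eval v t2
  | FNot _ f1 => fun v => ~ holds f1 v
  | FAnd _ f1 f2 => fun v => holds f1 v /\ holds f2 v
  | FOr _ f1 f2 => fun v => holds f1 v \/ holds f2 v
  | FImp _ f1 f2 => fun v => holds f1 v -> holds f2 v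
  | FForall _ f1 => fun v => forall x : A, holds f1 [tuple of x :: v]
  | FExists _ f1 => fun v => exists x : A, holds f1 [tuple of x :: v]
  end.

Definition tp (A : zmodType) n (a : n.-tuple A) : set (group_formula n) :=
  [set f | holds f a].

Definition omega_strongly_homogeneous (A : zmodType) : Prop :=
  forall n (a b : n.-tuple A), tp a = tp b ->
  exists2 phi : {additive A -> A},
    bijective phi & forall i : 'I_n, phi (tnth a i) = tnth b i.

Definition abelian_p_group (p : nat) (A : zmodType) : Prop :=
  forall x : A, exists k : nat, x *+ (p ^ k) = 0.

(** Subgroups are arbitrary (not only decidable) subsets of [A]. *)
Definition is_subgroup (A : zmodType) (S : set A) : Prop :=
  zmod_closed (mem S).

Definition divisible (A : zmodType) (S : set A) : Prop :=
  forall (n : nat) (x : A), (0 < n)%N -> S x -> exists2 y, S y & y *+ n = x.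

Definition reduced (A : zmodType) (S : set A) : Prop :=
  forall D : set A, is_subgroup D -> D `<=` S -> divisible D -> D = [set 0].

Definition is_direct_sum (A : zmodType) (D B : set A) : Prop :=
  (forall x : A, exists d b, [/\ D d, B b & x = d + b]) /\ D `&` B = [set 0].

Definition is_reduced_part (A : zmodType) (B : set A) : Prop :=
  [/\ is_subgroup B, reduced B &
      exists D : set A, [/\ is_subgroup D, divisible D & is_direct_sum D B]].

(** Heights are computed inside [S]: the solutions are required to lie in [S]. *)
Definition infinite_height (p : nat) (A : zmodType) (S : set A) (a : A) : Prop :=
  [/\ S a, a <> 0 & forall r : nat, exists2 x, S x & x *+ (p ^ r) = a].

Definition separable (p : nat) (A : zmodType) (S : set A) : Prop :=
  reduced S /\ forall a : A, ~ infinite_height p S a.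

(* Main.v *)
From HB Require Import structures.
Require Import Defs.
From mathcomp Require Import all_boot all_algebra.
From mathcomp Require Import boolp classical_sets.
From mathcomp Require Import cardinality.

(* Equality of types implies that t(a) |-> t(b), t ranging over the terms, is a
   well-defined isomorphism of finite subgroups preserving heights.  It is extended
   one generator at a time, composing automorphisms, which reduces the problem to:
   S is a finite subgroup, px = py lies in S, x + s and y + s have the same height
   for every s in S; move x to y by an automorphism fixing S.  Translating by an
   element of S, assume that x has maximal height n in its coset x + S, so that x
   and y lie outside T := S + p^(n+1) A (outside T := S if n is infinite).  The
   element z := y - x of order p is divisible by p^n, so it is the socle of a cyclic
   group E of order p^(n+1); if n is infinite, z lies in the divisible part and is
   the socle of a quasicyclic group E.  In both cases E is injective enough to extend
   the map killing T and sending x to z and y to some nonzero multiple of z to a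
   homomorphism theta : A -> E, and 1 + theta is the required automorphism.
   Separability is only used to see that the elements of infinite height form the
   divisible part. *)

Set Implicit Arguments.
Unset Strict Implicit.
Unset Printing Implicit Defensive.

Import GRing.Theory.
Local Open Scope classical_set_scope.
Local Open Scope ring_scope.

(** * Subgroups generated by one more element *)

(* In a p-group a submonoid is a subgroup: opposites are natural multiples. *)
Definition submonoid (V : zmodType) (S : set V) : Prop :=
  S 0 /\ forall u v, S u -> S v -> S (u + v).

Definition adjoin (V : zmodType) (S : set V) (x : V) : set V :=
  [set s + x *+ m | s in S & m in [set: nat]].

Lemma submonoid_muln (V : zmodType) (S : set V) (x : V) (m : nat) :
  submonoid S -> S x -> S (x *+ m).
Proof.
move=> [S0 SD] Sx; elim: m => [|m IHm]; first by rewrite mulr0n.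
by rewrite mulrS; exact: SD.
Qed.

Lemma submonoid_adjoin (V : zmodType) (S : set V) (x : V) :
  submonoid S -> submonoid (adjoin S x).
Proof.
move=> [S0 SD]; split; first by exists 0 => //; exists 0%N => //; rewrite mulr0n addr0.
move=> _ _ [s Ss [m _ <-]] [t St [k _ <-]].
exists (s + t); first exact: SD.
by exists (m + k)%N => //; rewrite mulrnDr addrACA.
Qed.

Lemma sub_adjoin (V : zmodType) (S : set V) (x : V) : S `<=` adjoin S x.
Proof. by move=> s Ss; exists s => //; exists 0%N => //; rewrite mulr0n addr0. Qed.

Lemma mem_adjoin (V : zmodType) (S : set V) (x : V) :
  submonoid S -> adjoin S x x.
Proof. by move=> [S0 _]; exists 0 => //; exists 1%N => //; rewrite add0r mulr1n. Qed.

Lemma mulrn_div (V : zmodType) (x : V) (d m : nat) :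
  (d %| m)%N -> x *+ d = 0 -> x *+ m = 0.
Proof. by move=> /dvdnP[k ->] xd0; rewrite mulnC mulrnA xd0 mul0rn. Qed.

Lemma coprime_mulrn (V : zmodType) (x : V) (m d : nat) :
  coprime m d -> x *+ d = 0 -> exists k, x *+ m *+ k = x.
Proof.
case: m => [|m] cop xd0.
  move: cop; rewrite /coprime gcd0n => /eqP d1.
  by exists 0%N; rewrite mulr0n -[RHS]mulr1n -d1 xd0.
have [k j eq_kj _] := egcdnP d (ltn0Sn m).
exists k; rewrite -mulrnA mulnC eq_kj (eqP cop) mulrnDr mulr1n.
by rewrite (mulrn_div _ xd0) ?add0r ?dvdn_mull.
Qed.

(** * Automorphisms as unbundled maps *)

Definition is_automorphism (A : zmodType) (phi : A -> A) : Prop :=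
  {morph phi : u v / u + v} /\ bijective phi.

Section Automorphisms.
Variables (A : zmodType) (phi : A -> A).
Hypothesis aut_phi : is_automorphism phi.

Lemma aut_is_additive : exists f : {additive A -> A}, f =1 phi.
Proof.
have [phiD _] := aut_phi.
have phi0 : phi 0 = 0 by apply: (addrI (phi 0)); rewrite -phiD !addr0.
have phiB : zmod_morphism phi.
  move=> u v; apply: (addIr (phi v)).
  by rewrite -phiD !subrK.
pose m := GRing.isZmodMorphism.Build A A phi phiB.
pose f : {additive A -> A} := HB.pack phi m.
by exists f.
Qed.

Lemma aut0 : phi 0 = 0.
Proof. by have [f <-] := aut_is_additive; rewrite raddf0. Qed.

Lemma aut_muln u m : phi (u *+ m) = phi u *+ m.
Proof. by have [f fE] := aut_is_additive; rewrite -!fE raddfMn. Qed.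

End Automorphisms.

Lemma aut_comp (A : zmodType) (phi psi : A -> A) :
  is_automorphism phi -> is_automorphism psi -> is_automorphism (psi \o phi).
Proof.
move=> [phiD phib] [psiD psib]; split; last exact: bij_comp.
by move=> u v /=; rewrite phiD psiD.
Qed.

Lemma aut_id (A : zmodType) : is_automorphism (@id A).
Proof. by split => //; exists id. Qed.

(** * Partial homomorphisms of p-groups and their extension *)

Section PGroups.
Variables (p : nat) (p_prime : prime p).
Implicit Types (A V : zmodType).

Lemma pgroup_opp V (S : set V) (x : V) :
  abelian_p_group p V -> submonoid S -> S x -> S (- x).
Proof.
move=> Vp subS Sx; have [k xk0] := Vp x.
suff -> : - x = x *+ (p ^ k).-1 by exact: submonoid_muln.
apply/eqP; rewrite eq_sym -subr_eq0 opprK addrC -mulrS prednK ?xk0 //.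
by rewrite expn_gt0 prime_gt0.
Qed.

Lemma finite_adjoin V (S : set V) (x : V) :
  abelian_p_group p V -> finite_set S -> finite_set (adjoin S x).
Proof.
move=> Vp finS; have [k xk0] := Vp x.
apply: (@sub_finite_set _ _ [set s + x *+ m | s in S & m in `I_(p ^ k)]).
  move=> _ [s Ss [m _ <-]]; exists s => //; exists (m %% p ^ k)%N.
    by rewrite /= ltn_pmod // expn_gt0 prime_gt0.
  congr (_ + _); rewrite [in RHS](divn_eq m (p ^ k)) mulrnDr.
  by rewrite mulnC mulrnA xk0 mul0rn add0r.
exact: finite_image2 finS (finite_II _).
Qed.

Lemma pair_muln A (u v : A) m : (u, v) *+ m = (u *+ m, v *+ m).
Proof. by elim: m => [|m IHm]; rewrite ?mulr0n // !mulrS IHm. Qed.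

Lemma pgroup_prod A : abelian_p_group p A ->
  abelian_p_group p (A * A)%type.
Proof.
move=> Ap [u v]; have [k uk0] := Ap u; have [j vj0] := Ap v.
exists (k + j)%N; rewrite pair_muln.
have -> : u *+ p ^ (k + j) = 0.
  by apply: (mulrn_div _ uk0); rewrite dvdn_exp2l // leq_addr.
by have -> : v *+ p ^ (k + j) = 0
  by apply: (mulrn_div _ vj0); rewrite dvdn_exp2l // leq_addl.
Qed.

(** The graph of a homomorphism from a subgroup of [A]. In a p-group [G] is closed under
    differences, so the condition over 0 makes it single-valued. *)
Definition partial_hom A (G : set (A * A)) : Prop :=
  submonoid G /\ forall v, G (0, v) -> v = 0.

(** Suppose [a *+ m] is in the domain of [G]. If [p] does not divide [m], then [a] is a multiple of
    [a *+ m], which is excluded; if it does, the value [e *+ m] is already forced by the pair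
    [(a *+ p, e *+ p)]. *)
Lemma partial_hom_adjoin A (G : set (A * A)) (a e : A) :
  abelian_p_group p A ->
  partial_hom G -> (forall v, ~ G (a, v)) -> G (a *+ p, e *+ p) ->
  partial_hom (adjoin G (a, e)).
Proof.
move=> Ap [subG funG] aG paG; split; first exact: submonoid_adjoin.
have Ap2 := pgroup_prod Ap.
move=> w [[t v] Gtv [m _]]; rewrite pair_muln => -[tm0 <-].
have mG : G (a *+ m, - v).
  by rewrite -(addr0_eq tm0); exact: pgroup_opp Ap2 subG Gtv.
have [cop|] := boolP (coprime m p).
  have [k ak] := Ap a.
  have [j aj] := @coprime_mulrn _ a m (p ^ k) (coprimeXr k cop) ak.
  have := submonoid_muln j subG mG; rewrite pair_muln aj.
  by move/aG.
rewrite coprime_sym prime_coprime // negbK => /dvdnP[j mE].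
have Gm : G (a *+ m, e *+ m).
  by have := submonoid_muln j subG paG; rewrite pair_muln -!mulrnA mulnC -mE.
apply: funG; have := subG.2 _ _ Gtv Gm; congr G; congr pair; exact: tm0.
Qed.


(* Baer's criterion; [extE] replaces divisibility of [E], since [E] may be cyclic. *)
Lemma partial_hom_extend A (E : set A) (G0 : set (A * A)) :
  abelian_p_group p A -> submonoid E -> partial_hom G0 ->
  (forall a e, G0 (a, e) -> E e) ->
  (forall G a e, partial_hom G -> G0 `<=` G -> G (a *+ p, e) -> E e ->
     exists2 e', E e' & e' *+ p = e) ->
  exists theta : A -> A, [/\ {morph theta : u v / u + v},
    (forall a, E (theta a)) & forall a e, G0 (a, e) -> theta a = e].
Proof.
move=> Ap subE homG0 G0E extE.
pose good (G : set (A * A)) :=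
  [/\ partial_hom G, forall a e, G (a, e) -> E e & G0 `<=` G].
have [F FP Ftot|G [Ggood Gmax]] := @Zorn_bigcup _ [set G | G = set0 \/ good G].
  have [allF0|] := pselect (F `<=` [set set0]).
    left; rewrite -subset0 => x [G FG Gx].
    by have := allF0 _ FG; rewrite /= => G0'; rewrite G0' in Gx.
  move=> /existsNP[G1 /not_implyP[FG1 G1n0]].
  have good1 G a : F G -> G a -> good G.
    by move=> FG Ga; have [G0'|//] := FP _ FG; rewrite G0' in Ga.
  have {G1n0}good_G1 : good G1 by have [|//] := FP _ FG1.
  right; split; [split; [split|]| |].
  - by exists G1 => //; case: good_G1 => -[[]].
  - move=> u v [G FG Gu] [H FH Hv].
    have [GH|HG] := Ftot _ _ FG FH.
      exists H => //; have [[[_ HD] _] _ _] := good1 _ _ FH Hv.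
      by apply: HD => //; exact: GH.
    exists G => //; have [[[_ GD] _] _ _] := good1 _ _ FG Gu.
    by apply: GD => //; exact: HG.
  - move=> v [G FG Gv]; have [[_ funG] _ _] := good1 _ _ FG Gv; exact: funG.
  - move=> a e [G FG Gv]; have [_ GE _] := good1 _ _ FG Gv; exact: GE Gv.
  - move=> u G0u; exists G1 => //; case: good_G1 => _ _; exact.
have {Ggood}[homG GE G0G] : good G.
  case: Ggood => // G_0; exfalso; apply: (Gmax G0); last by right; split.
  rewrite G_0; split; first exact: sub0set.
  by move=> /(_ 0); apply; case: homG0 => -[].
have [subG funG] := homG.
have GA a : exists e, G (a, e).
  apply: contrapT => /forallNP aG.
  (* For the least [k] with [a *+ p ^ k] in the domain, the preceding multiple lies outside it while
     its [p]-fold lies inside, so it can be adjoined. *)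
  pose dom k := `[< exists e, G (a *+ p ^ k, e) >].
  have ex_k : exists k, dom k.
    have [k ak] := Ap a; exists k; apply/asboolP; exists 0; rewrite ak; exact: subG.1.
  case: (ex_minnP ex_k) => -[|k] /asboolP[e Ge] kmin; first by case: (aG e).
  have ndk v : ~ G (a *+ p ^ k, v).
    move=> Gk; suff : (k.+1 <= k)%N by rewrite ltnn.
    by apply: kmin; apply/asboolP; exists v.
  rewrite expnSr mulrnA in Ge.
  have [e' Ee' e'p] := extE _ _ _ homG G0G Ge (GE _ _ Ge).
  rewrite -e'p in Ge.
  apply: (Gmax (adjoin G (a *+ p ^ k, e'))).
    split; first exact: sub_adjoin.
    move=> /(_ _ (mem_adjoin _ subG)); exact: ndk.
  right; split; first exact: partial_hom_adjoin.
    move=> b f [[t v] Gtv [m _]]; rewrite pair_muln => -[_ <-].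
    by apply: subE.2; [exact: GE Gtv|exact: submonoid_muln].
  by apply: subset_trans G0G _; exact: sub_adjoin.
have [theta Gtheta] := choice GA.
have funG2 a e e' : G (a, e) -> G (a, e') -> e = e'.
  move=> Gae Gae'; have := subG.2 _ _ Gae (pgroup_opp (pgroup_prod Ap) subG Gae').
  by move=> Gd; apply/eqP; rewrite -subr_eq0; apply/eqP/funG; rewrite -(subrr a).
exists theta; split => [u v|a|a e G0ae].
- exact: funG2 (Gtheta _) (subG.2 _ _ (Gtheta u) (Gtheta v)).
- exact: GE (Gtheta a).
- exact: funG2 (Gtheta a) (G0G _ G0ae).
Qed.

(** * Cyclic and quasicyclic groups *)

Section Chain.
Variables (A : zmodType) (zs : nat -> A) (K : set nat).
Hypothesis z_neq0 : zs 0 <> 0.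
Hypothesis zp0 : zs 0 *+ p = 0.
Hypothesis K0 : K 0.
Hypothesis Kpred : forall k, K k.+1 -> K k.
Hypothesis zsp : forall k, K k.+1 -> zs k.+1 *+ p = zs k.

(* Cyclic if [K] is an initial segment, quasicyclic if [K] is everything. *)
Definition chain_span : set A := [set zs k *+ c | k in K & c in [set: nat]].

Lemma chain_exp j i : K (i + j)%N -> zs (i + j)%N *+ p ^ i = zs j.
Proof.
elim: i => [|i IHi]; first by rewrite add0n mulr1n.
by rewrite addSn => Kij; rewrite expnS mulrnA zsp // IHi //; exact: Kpred.
Qed.

Lemma chain_sub j k : (j <= k)%N -> K k -> zs j = zs k *+ p ^ (k - j).
Proof.
by move=> jk Kk; have := @chain_exp j (k - j)%N; rewrite subnK // => /(_ Kk) ->.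
Qed.

Lemma chain_bot k : K k -> zs k *+ p ^ k = zs 0.
Proof. by have := @chain_exp 0 k; rewrite addn0. Qed.

Lemma chain0_mul c : zs 0 *+ c = 0 -> (p %| c)%N.
Proof.
move=> zc0; apply: contrapT => /negP; rewrite -prime_coprime // coprime_sym => cop.
have [j] := coprime_mulrn cop zp0.
by rewrite zc0 mul0rn => /esym.
Qed.

Lemma chain_exp0 k : K k -> zs k *+ p ^ k.+1 = 0.
Proof. by move=> Kk; rewrite expnSr mulrnA chain_bot. Qed.

Lemma submonoid_chain : submonoid chain_span.
Proof.
split; first by exists 0%N => //; exists 0%N => //; rewrite mulr0n.
have le_add j k c d : (j <= k)%N -> K k -> chain_span (zs j *+ c + zs k *+ d).
  move=> jk Kk; rewrite (chain_sub jk Kk) -mulrnA -mulrnDr.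
  by exists k => //; eexists.
move=> _ _ [k Kk [c _ <-]] [j Kj [d _ <-]].
have [jk|/ltnW kj] := leqP j k; last exact: le_add.
by rewrite addrC; exact: le_add.
Qed.

(** Factors [p] of the coefficient are absorbed by going down the chain. Once [c] is prime to [p],
    multiplying by a power of [p] gives [zs 0 *+ c], and [c] is invertible modulo [p]. *)
Lemma chain_essential e : chain_span e -> e <> 0 -> exists m, e *+ m = zs 0.
Proof.
move=> [k Kk [c _ <-]]; elim: k Kk c => [|k IHk] Kk c e_neq0.
all: have [/dvdnP[d cE]|] := boolP (p %| c)%N.
- by case: e_neq0; rewrite cE mulnC mulrnA zp0 mul0rn.
- rewrite -prime_coprime // coprime_sym => cop.
  by have [m mE] := coprime_mulrn cop zp0; exists m.
- have eE : zs k.+1 *+ c = zs k *+ d by rewrite cE mulnC mulrnA zsp.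
  by rewrite eE in e_neq0 *; apply: IHk => //; exact: Kpred.
- rewrite -prime_coprime // coprime_sym => cop.
  have [m mE] := coprime_mulrn cop zp0; exists (p ^ k.+1 * m)%N.
  by rewrite -mE mulrnA; congr (_ *+ m); rewrite mulrnAC chain_bot.
Qed.

(** Above level [k], the bound on the order makes [c] kill [zs 0], so [p] divides [c] and the level
    drops. Hence an additive map from [chain_span] to itself multiplies each [zs k] by an
    integer. *)
Lemma chain_uniserial k e : K k -> chain_span e -> e *+ p ^ k.+1 = 0 ->
  exists m, e = zs k *+ m.
Proof.
move=> Kk [j Kj [c _ <-]]; elim: j Kj c => [|j IHj] Kj c e0.
  by exists (p ^ (k - 0) * c)%N; rewrite (chain_sub (leq0n k) Kk) mulrnA.
have [jk|kj] := leqP j.+1 k.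
  by exists (p ^ (k - j.+1) * c)%N; rewrite (chain_sub jk Kk) mulrnA.
have /dvdnP[d cE] : (p %| c)%N.
  apply: chain0_mul; rewrite -(chain_bot Kj).
  have -> : (p ^ j.+1 = p ^ k.+1 * p ^ (j - k))%N by rewrite -expnD addSn subnKC.
  by rewrite mulrnAC mulrnA e0 mul0rn.
have eE : zs j.+1 *+ c = zs j *+ d by rewrite cE mulnC mulrnA zsp.
by rewrite eE in e0 *; apply: IHj => //; exact: Kpred.
Qed.

End Chain.


(** * Automorphisms of the form [1 + theta] *)

Lemma aut_of_additive A (phi : A -> A) : {morph phi : u v / u + v} ->
  (forall u, phi u = 0 -> u = 0) -> (forall v, exists u, phi u = v) ->
  is_automorphism phi.
Proof.
move=> phiD phi_ker phi_surj; split=> //.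
have phiB u v : phi u = phi v -> u = v.
  move=> uv; apply/eqP; rewrite -subr_eq0; apply/eqP/phi_ker/(addIr (phi v)).
  by rewrite -phiD subrK add0r.
have [psi psiK] := choice phi_surj.
by exists psi => // u; apply: phiB; rewrite psiK.
Qed.

(* [1 + theta] is an automorphism because [theta] maps into the uniserial group
   [E := chain_span zs K], acts there by multiplications, and [1 + theta] does
   not kill the socle element [zs 0]. *)
Lemma move_by_chain A (T : set A) (x y : A) (zs : nat -> A) (K : set nat) :
  abelian_p_group p A -> submonoid T -> ~ T x -> ~ T y -> x <> y ->
  T (x *+ p) -> x *+ p = y *+ p -> zs 0 = y - x ->
  K 0 -> (forall k, K k.+1 -> K k) ->
  (forall k, K k.+1 -> zs k.+1 *+ p = zs k) ->
  (forall k, K k) \/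
    (exists n, (forall k, K k <-> (k <= n)%N) /\ forall a, T (a *+ p ^ n.+1)) ->
  exists phi, [/\ is_automorphism phi, forall t, T t -> phi t = t & phi x = y].
Proof.
move=> Ap subT Tx Ty xy Txp xyp zE K0 Kpred zsp Kcase.
have z_neq0 : zs 0 <> 0 by rewrite zE => /subr0_eq /esym.
have zp0 : zs 0 *+ p = 0 by rewrite zE mulrnBl xyp subrr.
set E := chain_span zs K.
have subE : submonoid E by exact: submonoid_chain.
have Ez : E (zs 0) by exists 0%N => //; exists 1%N.
pose G1 : set (A * A) := [set ab | T ab.1 /\ ab.2 = 0].
have homG1 : partial_hom G1.
  split; last by move=> v [].
  split; first by split => //; exact: subT.1.
  by move=> u v [Tu u0] [Tv v0]; split; [exact: subT.2|rewrite /= u0 v0 addr0].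
have xpG1 : G1 (x *+ p, zs 0 *+ p) by split.
pose G2 := adjoin G1 (x, zs 0).
have homG2 : partial_hom G2.
  by apply: partial_hom_adjoin => // v [].
have adjE (G : set (A * A)) (u e : A) : (forall a e, G (a, e) -> E e) -> E e ->
    forall a f, adjoin G (u, e) (a, f) -> E f.
  move=> GE Ee a f [[t v] Gtv [m _]]; rewrite pair_muln => -[_ <-].
  by apply: subE.2; [exact: GE Gtv|exact: submonoid_muln].
have G1E a e : G1 (a, e) -> E e by move=> [_ /= ->]; exact: subE.1.
have G2E : forall a e, G2 (a, e) -> E e by exact: adjE.
have G1G2 : G1 `<=` G2 by exact: sub_adjoin.
have G2x : G2 (x, zs 0) by apply: mem_adjoin; case: homG1.
(* The value at [y] must be nonzero. If [G2] already determines it, a zero value would make the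
   coefficient of [x] divisible by [p] and put [y] in [T]; otherwise [zs 0] is chosen. *)
have [G0 [homG0 G0E G2G0 [w w0 G0y]]] : exists G0, [/\ partial_hom G0,
    forall a e, G0 (a, e) -> E e, G2 `<=` G0 & exists2 w, w <> 0 & G0 (y, w)].
  have [[w G2y]|yG2] := pselect (exists w, G2 (y, w)).
    exists G2; split => //; exists w => // w0; apply: Ty.
    case: G2y => -[t v] [/= Tt v0] [m _]; rewrite pair_muln v0 w0 => -[<-].
    rewrite add0r => /(chain0_mul z_neq0 zp0) /dvdnP[d ->].
    by apply: subT.2 => //; rewrite mulnC mulrnA; exact: submonoid_muln.
  exists (adjoin G2 (y, zs 0)); split.
  - apply: partial_hom_adjoin => //; first by move=> v G2y; apply: yG2; exists v.
    by apply: G1G2; split => //=; rewrite -xyp.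
  - exact: adjE.
  - exact: sub_adjoin.
  - by exists (zs 0) => //; apply: mem_adjoin; case: homG2.
have [G a e homG G0G Ge Ee|theta [thetaD thetaE theta_ext]] :=
    partial_hom_extend Ap subE homG0 G0E.
  case: Ee Ge => k Kk [c _ <-] Ge.
  have succ : K k.+1 -> exists2 e', E e' & e' *+ p = zs k *+ c.
    move=> Kk1; exists (zs k.+1 *+ c); first by exists k.+1 => //; exists c.
    by rewrite mulrnAC zsp.
  case: Kcase => [allK|[n [Kn Tpn]]]; first exact: succ.
  have := Kn k; rewrite leq_eqVlt => -[/(_ Kk) /orP[/eqP kn|kn] _]; last exact/succ/Kn.
  (* At the top level [n] there is no next [zs]. But [G] sends [a *+ p ^ n.+1], an element of [T],
     both to 0 and to [zs n *+ c *+ p ^ n], that is [zs 0 *+ c]. *)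
  suff /dvdnP[d ->] : (p %| c)%N.
    exists (zs k *+ d); first by exists k => //; exists d.
    by rewrite mulrnA.
  apply: (chain0_mul z_neq0 zp0); rewrite -(chain_bot Kpred zsp Kk) mulrnAC kn.
  have [subG funG] := homG; apply: funG.
  have Gpn : G (a *+ p ^ n.+1, 0) by apply/G0G/G2G0/G1G2; split => //=; exact: Tpn.
  have := submonoid_muln (p ^ n) subG Ge.
  rewrite pair_muln -[a *+ p *+ _]mulrnA -expnS kn => Gpn'.
  have Gd := subG.2 _ _ Gpn' (pgroup_opp (pgroup_prod Ap) subG Gpn).
  rewrite -(subrr (a *+ p ^ n.+1)) -[X in G (_, X)]subr0; exact: Gd.
have theta_mul u m : theta (u *+ m) = theta u *+ m.
  have theta0 : theta 0 = 0 by apply: (addrI (theta 0)); rewrite -thetaD !addr0.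
  by elim: m => [|m IHm]; rewrite ?mulr0n // !mulrS thetaD IHm.
pose phi u := u + theta u.
have phi_mul u m : phi (u *+ m) = phi u *+ m by rewrite /phi theta_mul mulrnDl.
have phix : phi x = y.
  by rewrite /phi (theta_ext _ _ (G2G0 _ G2x)) zE addrC subrK.
have phiD : {morph phi : u v / u + v} by move=> u v; rewrite /phi thetaD addrACA.
(* Otherwise [y = x + zs 0] and [x] have the same image [y], so [theta y = 0]. *)
have phiz : phi (zs 0) <> 0.
  rewrite -(theta_ext _ _ G0y) in w0; move=> phiz; apply: w0.
  have : phi (x + zs 0) = y by rewrite phiD phiz addr0.
  by rewrite zE addrC subrK /phi -[RHS]addr0 => /addrI.
exists phi; split=> //; last first.
  by move=> t Tt; rewrite /phi (theta_ext t 0) ?addr0 //; exact/G2G0/G1G2.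
apply: aut_of_additive => // [u phiu|v].
  apply: contrapT => u0; apply: phiz.
  have Eu : E u.
    have -> : u = - theta u by apply/eqP; rewrite -addr_eq0; apply/eqP.
    exact: pgroup_opp.
  have [m <-] : exists m, u *+ m = zs 0 by exact: chain_essential Eu u0.
  by rewrite phi_mul phiu mul0rn.
(* Since [phi v = v + theta v], it suffices to reach [theta v], which lies in [E]; there [phi]
   multiplies [zs k] by [m.+1], prime to [p] because [phi] does not kill the socle. *)
suff [e phie] : exists e, phi e = theta v.
  exists (v - e); apply: (addIr (phi e)).
  by rewrite -phiD subrK phie.
case: (thetaE v) => k Kk [c _ <-].
have [m mE] : exists m, theta (zs k) = zs k *+ m.
  apply: (chain_uniserial z_neq0 zp0 Kpred zsp Kk (thetaE _)).
  rewrite -theta_mul (chain_exp0 zp0 Kpred zsp Kk).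
  by apply: (addrI (theta 0)); rewrite -thetaD !addr0.
have phik : phi (zs k) = zs k *+ m.+1 by rewrite /phi mE mulrS.
have cop : coprime m.+1 (p ^ k.+1).
  rewrite coprimeXr // coprime_sym prime_coprime //; apply/negP => /dvdnP[d mE'].
  apply: phiz; rewrite -(chain_bot Kpred zsp Kk) phi_mul phik mE' mulrnAC.
  by rewrite (chain_bot Kpred zsp Kk) mulnC mulrnA zp0 mul0rn.
have [j jE] := coprime_mulrn cop (chain_exp0 zp0 Kpred zsp Kk).
by exists (zs k *+ j *+ c); rewrite !phi_mul phik jE.
Qed.


(** * Heights *)

Definition height_ge A (r : nat) (u : A) : Prop := exists w, w *+ p ^ r = u.

(* All [height_ge r] hold both at 0 and at elements of divisible subgroups, hence
   the separate clause on 0. *)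
Definition same_height A (u v : A) : Prop :=
  (u = 0 <-> v = 0) /\ forall r, height_ge r u <-> height_ge r v.

Lemma height_geB A r (u v : A) :
  height_ge r u -> height_ge r v -> height_ge r (u - v).
Proof. by move=> [u' <-] [v' <-]; exists (u' - v'); rewrite mulrnBl. Qed.

Lemma height_ge_le A r k (u : A) : (k <= r)%N -> height_ge r u -> height_ge k u.
Proof.
move=> kr [w <-]; exists (w *+ p ^ (r - k)).
by rewrite -mulrnA -expnD subnK.
Qed.

Lemma height_total A (u v : A) :
  (forall r, height_ge r u -> height_ge r v) \/
  (forall r, height_ge r v -> height_ge r u).
Proof.
have [?|/existsNP[r /not_implyP[ur vr]]] :=
    pselect (forall r, height_ge r u -> height_ge r v); first by left.
right=> k vk; apply: height_ge_le ur.
by rewrite leqNgt; apply/negP => /ltnW rk; apply: vr; exact: height_ge_le vk.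
Qed.

(** Heights, infinite ones included, are totally ordered by [height_total], so a finite coset
    attains its maximum. *)
Lemma coset_max_height A (S : set A) (x : A) : finite_set S -> S !=set0 ->
  exists2 s0, S s0 & forall s r, S s -> height_ge r (x + s) -> height_ge r (x + s0).
Proof.
move=> /finite_seqP[l ->].
elim: l => [|t l IHl]; first by case=> ?; rewrite /= in_nil.
move=> _; case: l IHl => [_|t' l IHl].
  by exists t; [exact: mem_head|move=> s r /=; rewrite mem_seq1 => /eqP ->].
have [|s0 s0l s0max] := IHl; first by exists t'; exact: mem_head.
have [le|le] := height_total (x + t) (x + s0).
  exists s0 => [|s r /=]; first by rewrite /= in_cons s0l orbT.
  by rewrite in_cons => /orP[/eqP ->|]; [exact: le|exact: s0max].
exists t => [|s r /=]; first exact: mem_head.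
by rewrite in_cons => /orP[/eqP -> //|sl sr]; apply/le/(s0max s).
Qed.

Lemma same_height_aut A (phi : A -> A) (u : A) :
  is_automorphism phi -> same_height (phi u) u.
Proof.
move=> aut_phi; have [_ [psi phiK psiK]] := aut_phi; split.
  split=> [phiu|->]; last exact: aut0.
  by rewrite -[u]phiK phiu -{1}(aut0 aut_phi) phiK.
move=> r; split=> -[w wE]; last by exists (phi w); rewrite -aut_muln // wE.
exists (psi w); rewrite -[LHS]phiK aut_muln // psiK wE; exact: phiK.
Qed.

Lemma same_height_trans A (u v w : A) :
  same_height u v -> same_height v w -> same_height u w.
Proof.
by move=> [uv0 uv] [vw0 vw]; split=> [|r]; [rewrite uv0|rewrite uv].
Qed.

(** * Moving one element, then a tuple *)

Section Homogeneity.
Variable A : zmodType.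
Hypothesis A_pgroup : abelian_p_group p A.
Hypothesis infinite_height_divisible : forall x : A,
  (forall r, height_ge r x) -> exists2 y, (forall r, height_ge r y) & y *+ p = x.

Lemma aut_move_prime (S : set A) (x y : A) :
  submonoid S -> finite_set S -> S (x *+ p) -> x *+ p = y *+ p ->
  (forall s, S s -> same_height (x + s) (y + s)) ->
  exists phi, [/\ is_automorphism phi, forall s, S s -> phi s = s & phi x = y].
Proof.
move=> subS finS Sxp xyp xyS.
have [<-|xy] := pselect (x = y); first by exists id; split => //; exact: aut_id.
have S0 : S 0 by exact: subS.1.
have SN u : S u -> S (- u) by exact: pgroup_opp.
have xS : ~ S x.
  move=> Sx; apply: xy; have [[xy0 _] _] := xyS _ (SN _ Sx).
  by apply/esym/subr0_eq/xy0; rewrite subrr.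
have yS : ~ S y.
  move=> Sy; apply: xy; have [[_ yx0] _] := xyS _ (SN _ Sy).
  by apply/subr0_eq/yx0; rewrite subrr.
have [s0 Ss0 s0max] := coset_max_height x finS (ex_intro _ 0 S0).
have move_coset (T : set A) (zs : nat -> A) (K : set nat) : submonoid T -> S `<=` T ->
    ~ T (x + s0) -> ~ T (y + s0) -> zs 0 = (y + s0) - (x + s0) ->
    K 0 -> (forall k, K k.+1 -> K k) ->
    (forall k, K k.+1 -> zs k.+1 *+ p = zs k) ->
    (forall k, K k) \/
      (exists n, (forall k, K k <-> (k <= n)%N) /\ forall a, T (a *+ p ^ n.+1)) ->
    exists phi, [/\ is_automorphism phi, forall s, S s -> phi s = s & phi x = y].
  move=> subT ST Tx Ty zE K0 Kpred zsp Kcase.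
  have [|||phi [aut_phi phiT phix]] :=
      move_by_chain A_pgroup subT Tx Ty _ _ _ zE K0 Kpred zsp Kcase.
  - by move=> /addIr.
  - by rewrite mulrnDl; apply/ST/subS.2 => //; exact: submonoid_muln.
  - by rewrite !mulrnDl xyp.
  exists phi; split=> // [s Ss|]; first exact/phiT/ST.
  by apply: (addIr (phi s0)); rewrite -aut_phi.1 phix phiT //; exact: ST.
have [_ xys0] := xyS _ Ss0.
have [infx|] := pselect (forall r, height_ge r (x + s0)).
  (* A total root function, arbitrary off the elements of infinite height; iterating it from the
     difference gives the quasicyclic chain. *)
  have halve (u : A) : exists v, (forall r, height_ge r u) ->
      (forall r, height_ge r v) /\ v *+ p = u.
    have [infu|] := pselect (forall r, height_ge r u); last by exists 0.
    by have [v] := infinite_height_divisible infu; exists v.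
  have [g gP] := choice halve.
  pose zs k := iter k g ((y + s0) - (x + s0)).
  have zs_inf k r : height_ge r (zs k).
    elim: k r => [|k IHk] r; first by apply: height_geB => //; exact/xys0.
    by have [+ _] := gP _ IHk; apply.
  apply: (@move_coset S zs setT) => //.
  - by move=> Sxs; apply: xS; rewrite -[x](addrK s0); apply: subS.2 => //; exact: SN.
  - by move=> Sys; apply: yS; rewrite -[y](addrK s0); apply: subS.2 => //; exact: SN.
  - by move=> k _; have [_] := gP _ (zs_inf k).
  - by left.
move=> /existsNP[r0 not_r0].
pose ngt k := ~~ `[< height_ge k (x + s0) >].
have ex_ngt : exists k, ngt k by exists r0; apply/negP => /asboolP.
(* The least failing exponent is [n.+1], so [x + s0] has height exactly [n]; exponent 0 never
   fails. *)
case: (ex_minnP ex_ngt) => -[|n] /negP nn nmin.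
  by case: nn; apply/asboolP; exists (x + s0); rewrite mulr1n.
have xn : height_ge n (x + s0).
  apply: contrapT => xn; suff : (n.+1 <= n)%N by rewrite ltnn.
  by apply: nmin; apply/negP => /asboolP.
have xn1 s : S s -> ~ height_ge n.+1 (x + s).
  by move=> Ss /(s0max _ _ Ss) ?; apply: nn; apply/asboolP.
have [z zE] : height_ge n ((y + s0) - (x + s0)) by apply: height_geB => //; exact/xys0.
pose T : set A := [set s + u *+ p ^ n.+1 | s in S & u in [set: A]].
(* The top term [zs n] is [z] and [zs 0] is the difference; truncated subtraction is harmless
   because [K] stops at [n]. *)
pose zs k := z *+ p ^ (n - k).
apply: (@move_coset T zs [set k | (k <= n)%N]); rewrite /zs /=.
- split; first by exists 0 => //; exists 0 => //; rewrite mul0rn addr0.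
  move=> _ _ [s Ss [u _ <-]] [t St [v _ <-]]; exists (s + t); first exact: subS.2.
  by exists (u + v) => //; rewrite mulrnDl addrACA.
- by move=> s Ss; exists s => //; exists 0 => //; rewrite mul0rn addr0.
- move=> [s Ss [u _ sE]]; apply: (xn1 (s0 - s)); first by apply: subS.2 => //; exact: SN.
  by exists u; rewrite addrA -sE addrAC subrr add0r.
- move=> [s Ss [u _ sE]].
  have Sss : S (s0 - s) by apply: subS.2 => //; exact: SN.
  have [_ xyss] := xyS _ Sss; apply: (xn1 (s0 - s)) => //; apply/xyss.
  by exists u; rewrite addrA -sE addrAC subrr add0r.
- by rewrite subn0.
- by [].
- by move=> k /ltnW.
- by move=> k kn; rewrite -mulrnA -expnSr subnSK.
- right; exists n; split => // a; exists 0 => //; exists a => //; exact: add0r.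
Qed.

(** By induction [psi] fixes [S] and sends [x *+ p] to [y *+ p]. Then [psi x] and [y] have the same
    [p]-fold, and the prime step applies over [adjoin S (y *+ p)], where translates of [psi x] and
    [y] are again combinations covered by the hypothesis. *)
Lemma aut_move (k : nat) (S : set A) (x y : A) :
  submonoid S -> finite_set S -> S (x *+ p ^ k) ->
  (forall s m, S s -> same_height (x *+ m + s) (y *+ m + s)) ->
  exists phi, [/\ is_automorphism phi, forall s, S s -> phi s = s & phi x = y].
Proof.
elim: k S x y => [|k IHk] S x y subS finS Sx xyS.
  have Sx' : S (- x) by apply: pgroup_opp => //; rewrite -[x]mulr1n.
  have [[xy0 _] _] := xyS _ 1%N Sx'.
  exists id; split=> //; first exact: aut_id.
  by apply/esym/subr0_eq; rewrite -[y]mulr1n; apply: xy0; rewrite mulr1n subrr.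
have [||psi [aut_psi psiS psix]] := IHk S (x *+ p) (y *+ p) subS finS.
- by rewrite -mulrnA -expnS.
- by move=> s m Ss; rewrite -!mulrnA; exact: xyS.
rewrite aut_muln // in psix.
have xyS' s m : S s -> same_height (psi x *+ m + s) (y *+ m + s).
  move=> Ss; apply: same_height_trans (xyS _ _ Ss).
  by rewrite -[X in _ + X](psiS s Ss) -aut_muln // -aut_psi.1; exact: same_height_aut.
have [||phi [aut_phi phiS phix]] := @aut_move_prime (adjoin S (y *+ p)) (psi x) y
    (submonoid_adjoin _ subS) (finite_adjoin _ A_pgroup finS) _ psix.
- by rewrite psix; exact: mem_adjoin.
- move=> _ [s Ss [m _ <-]].
  have -> : psi x + (s + y *+ p *+ m) = psi x *+ (p * m).+1 + s.
    by rewrite -psix -mulrnA mulrS -addrA [s + _]addrC.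
  have -> : y + (s + y *+ p *+ m) = y *+ (p * m).+1 + s.
    by rewrite -mulrnA mulrS -addrA [s + _]addrC.
  exact: xyS'.
exists (phi \o psi); split => [|s Ss|//]; first exact: aut_comp.
by rewrite /= psiS // phiS //; exact: sub_adjoin.
Qed.

Lemma aut_of_same_height (R : set (A * A)) (l : seq (A * A)) :
  submonoid R -> (forall u v, R (u, v) -> same_height u v) ->
  {in l, forall uv, R uv} ->
  exists2 phi, is_automorphism phi & {in l, forall uv, phi uv.1 = uv.2}.
Proof.
move=> subR Rh lR.
suff [Q [subQ finQ QR lQ [phi aut_phi phiQ]]] : exists Q, [/\ submonoid Q, finite_set Q,
    Q `<=` R, {in l, forall uv, Q uv} & exists2 phi, is_automorphism phi &
    forall u v, Q (u, v) -> phi u = v].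
  by exists phi => // -[u v] /lQ /phiQ.
elim: l lR => [|[x y] l IHl] lR.
  exists [set 0]; split => //; first by split => // u v -> ->; rewrite addr0.
    by move=> _ ->; exact: subR.1.
  by exists id; [exact: aut_id|move=> u v [-> ->]].
have [|Q [subQ finQ QR lQ [phi aut_phi phiQ]]] := IHl.
  by move=> uv uvl; apply: lR; rewrite in_cons uvl orbT.
have Rxy : R (x, y) by apply: lR; exact: mem_head.
have [k xk] := A_pgroup (phi x).
have subQ2 : submonoid [set uv.2 | uv in Q].
  split; first by exists 0 => //; exact: subQ.1.
  by move=> _ _ [u Qu <-] [v Qv <-]; exists (u + v) => //; exact: subQ.2.
(* [phi] already handles the earlier pairs; [psi] fixes their targets and moves [phi x] to [y].
   Heights agree because [phi x *+ m + v] is the image under [phi] of [x *+ m + u]. *)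
have [||psi [aut_psi psiQ psix]] := @aut_move k [set uv.2 | uv in Q] (phi x) y subQ2
    (finite_image _ finQ).
- by rewrite xk; exact: subQ2.1.
- move=> _ m [[u v] Quv <-] /=.
  apply: (@same_height_trans _ _ (x *+ m + u)).
    by rewrite -(phiQ _ _ Quv) -aut_muln // -aut_phi.1; exact: same_height_aut.
  apply: Rh; have := subR.2 _ _ (submonoid_muln m subR Rxy) (QR _ Quv).
  by rewrite pair_muln.
exists (adjoin Q (x, y)); split.
- exact: submonoid_adjoin.
- by apply: finite_adjoin => //; exact: pgroup_prod.
- by move=> _ [uv Quv [m _ <-]]; apply: subR.2; [exact: QR|exact: submonoid_muln].
- move=> uv; rewrite in_cons => /orP[/eqP ->|/lQ Quv]; first exact: mem_adjoin.
  exact: sub_adjoin.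
exists (psi \o phi); first exact: aut_comp.
move=> u' v' [[u v] Quv [m _]]; rewrite pair_muln => -[<- <-].
rewrite /= aut_phi.1 aut_psi.1 (aut_muln aut_phi) (aut_muln aut_psi).
rewrite psix (phiQ _ _ Quv) psiQ //.
by exists (u, v).
Qed.

End Homogeneity.

End PGroups.

(** * Elements of infinite height *)

Lemma subgroup_submonoid (A : zmodType) (S : set A) :
  is_subgroup S -> submonoid S /\ forall u, S u -> S (- u).
Proof.
move=> [S0 SB]; rewrite inE in S0.
have SN u : S u -> S (- u).
  by move=> Su; have := SB 0 u; rewrite !inE sub0r; exact.
do 2?split => //; move=> u v Su Sv.
by have := SB u (- v); rewrite !inE opprK; apply => //; exact: SN.
Qed.

(** Projecting roots of [x] along [D] shows that its component in [B] has all [p ^ r]-th roots in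
    [B], so it vanishes by separability. Thus [x] lies in [D], where a root and all its further
    roots exist. *)
Lemma reduced_part_infinite_height (p : nat) (p_prime : prime p) (A : zmodType)
    (B : set A) : is_reduced_part B -> separable p B ->
  forall x : A, (forall r, height_ge p r x) ->
  exists2 y, (forall r, height_ge p r y) & y *+ p = x.
Proof.
move=> [/subgroup_submonoid[subB BN] _ [D [/subgroup_submonoid[subD DN] divD [AE DB]]]].
move=> [_ sepB] x infx; have [d [b [Dd Bb xE]]] := AE x.
suff b0 : b = 0.
  have [y Dy yp] := divD p d (prime_gt0 p_prime) Dd.
  exists y; last by rewrite xE b0 addr0.
  move=> r; have [|w _ wE] := divD (p ^ r)%N y _ Dy; last by exists w.
  by rewrite expn_gt0 prime_gt0.
apply: contrapT => b0; apply: (sepB b); split => // r.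
have [w wx] := infx r; have [dw [bw [Ddw Bbw wE]]] := AE w.
exists bw => //; apply/eqP; rewrite -subr_eq0; apply/eqP.
suff : (D `&` B) (bw *+ p ^ r - b) by rewrite DB.
split; last by apply: subB.2; [exact: submonoid_muln|exact: BN].
have -> : bw *+ p ^ r - b = d - dw *+ p ^ r.
  apply/eqP; rewrite subr_eq addrAC eq_sym subr_eq -xE -wx wE mulrnDl.
  by rewrite addrC.
by apply: subD.2 => //; apply: DN; exact: submonoid_muln.
Qed.

(** * From types to heights *)

Fixpoint term_muln n (t : group_term n) (m : nat) : group_term n :=
  if m is m'.+1 then TAdd t (term_muln t m') else TZero n.

Lemma term_eval_muln (A : zmodType) n (v : n.-tuple A) (t : group_term n) m :
  term_eval v (term_muln t m) = term_eval v t *+ m.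
Proof. by elim: m => [|m IHm] /=; rewrite ?mulr0n // IHm mulrS. Qed.

Fixpoint term_shift n (t : group_term n) : group_term n.+1 :=
  match t with
  | TVar i => TVar (lift ord0 i)
  | TZero => TZero n.+1
  | TOpp t1 => TOpp (term_shift t1)
  | TAdd t1 t2 => TAdd (term_shift t1) (term_shift t2)
  end.

Lemma term_eval_shift (A : zmodType) n (v : n.-tuple A) (x : A) (t : group_term n) :
  term_eval [tuple of x :: v] (term_shift t) = term_eval v t.
Proof.
by elim: t => [i||t1 IH1|t1 IH1 t2 IH2] /=; rewrite ?tnthS ?IH1 ?IH2.
Qed.

(** Vanishing of [t] and, for each [r], solvability of [x *+ p ^ r = t] are first-order conditions
    on the tuple. *)
Lemma tp_same_height (p : nat) (A : zmodType) n (a b : n.-tuple A) (t : group_term n) :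
  tp a = tp b -> same_height p (term_eval a t) (term_eval b t).
Proof.
move=> tpab; have holdsE f : holds f a = holds f b := congr1 (fun X => X f) tpab.
split; first by have /= -> := holdsE (FEq t (TZero n)).
move=> r.
pose f := FExists (FEq (term_muln (TVar ord0) (p ^ r)) (term_shift t)).
have fE (v : n.-tuple A) : holds f v <-> height_ge p r (term_eval v t).
  by split=> -[w] wE; exists w; move: wE => /=;
    rewrite term_eval_muln term_eval_shift /= tnth0.
by rewrite -!fE holdsE.
Qed.

Theorem corollary5p4 (p : nat) (p_prime : prime p) (A : zmodType)
    (A_pgroup : abelian_p_group p A) (B : set A)
    (B_reduced_part : is_reduced_part B) (B_separable : separable p B) :
  omega_strongly_homogeneous A.
Proof.
move=> n a b tpab.
(* [R] need not be known to be single-valued: comparing heights, with their clause on 0, is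
   enough. *)
pose R : set (A * A) := [set uv | exists t, uv = (term_eval a t, term_eval b t)].
have subR : submonoid R.
  split; first by exists (TZero n).
  by move=> _ _ [t ->] [t' ->]; exists (TAdd t t').
have [u v [t [-> ->]]||phi aut_phi phiE] := aut_of_same_height p_prime A_pgroup
    (reduced_part_infinite_height p_prime B_reduced_part B_separable)
    (l := [seq (tnth a i, tnth b i) | i <- enum 'I_n]) subR.
- exact: tp_same_height.
- by move=> _ /mapP[i _ ->]; exists (TVar i).
have [f fE] := aut_is_additive aut_phi.
exists f; first by apply: eq_bij aut_phi.2 _ _ => u; rewrite fE.
move=> i; rewrite fE; apply: (phiE (tnth a i, tnth b i)).
by apply: map_f; rewrite mem_enum.
Qed.
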